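(* Let $f,g\in\mathcal B_1(2^\omega)$. If $|f|_\alpha<|g|_\alpha$ then $f\le_{\mathbf m} g$. If $|f|_\alpha=|g|_\alpha$, then $f\le_{\mathbf m} g$ if and only if at least one of the following holds: (1) $|f|_\alpha$ is a limit ordinal; (2) $g$ is two-sided; (3) $f$ is one-sided and $g$ is neither right-sided nor left-sided; (4) $f$ and $g$ are both right-sided, or both left-sided.
   Context: $\mathcal B_1(2^\omega)$ is the set of functions $2^\omega\to\mathbb R$ that are pointwise limits of sequences of continuous functions. Optimal derivation sequence: for $\mathcal C\subseteq\mathcal P(X)$, $X$ a compact metric space, define $P^0=X$, $P^{\nu+1}=P^\nu\setminus\bigcup\{U\subseteq X \text{ open}: P^\nu\cap U\subseteq C\text{ for some }C\in\mathcal C\}$, and $P^\lambda=\bigcap_{\nu<\lambda}P^\nu$ for limit $\lambda$. Bourgain rank: for $f\in\mathcal B_1(2^\omega)$, $p\in\mathbb Q$, $\varepsilon\in\mathbb Q^+$, let $P^\nu_{f,p,\varepsilon}$ be the optimal derivation sequence for $\{f^{-1}((-\infty,p+\varepsilon)),f^{-1}((p-\varepsilon,\infty))\}$, let $\alpha(f,p,\varepsilon)$ be the least $\nu$ with $P^\nu_{f,p,\varepsilon}=\emptyset$ (it exists and is a successor), and $|f|_\alpha=\sup_{p,\varepsilon}\alpha(f,p,\varepsilon)$. Sidedness: suppose $|f|_\alpha=\nu+1$. A pair $(p,\varepsilon)$ is maximal for $f$ if $\alpha(f,p,\varepsilon)=\nu+1$ and $f(P^\nu_{f,p,\varepsilon})\setminus(p-\varepsilon,p+\varepsilon)\ne\emptyset$.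 $f$ is two-sided if there is a maximal $(p,\varepsilon)$ with $f(P^\nu_{f,p,\varepsilon})\not\subseteq(p-\varepsilon,\infty)$ and $f(P^\nu_{f,p,\varepsilon})\not\subseteq(-\infty,p+\varepsilon)$; one-sided otherwise; left-sided if for every maximal $(p,\varepsilon)$, $f(P^\nu_{f,p,\varepsilon})\subseteq(-\infty,p+\varepsilon)$; right-sided if for every maximal $(p,\varepsilon)$, $f(P^\nu_{f,p,\varepsilon})\subseteq(p-\varepsilon,\infty)$. Questions: for $y\in\mathbb R$, $p\in\mathbb Q$, $\varepsilon\in\mathbb Q^+$, a bit $b\in\{0,1\}$ is a correct answer to ''$y\lesssim_\varepsilon p$'' if either $b=1$ and $y<p+\varepsilon$, or $b=0$ and $y>p-\varepsilon$. $f\le_{\mathbf m} g$ means: for every $p\in\mathbb Q,\varepsilon\in\mathbb Q^+$ there are $q\in\mathbb Q,\delta\in\mathbb Q^+$ and a continuous $k:2^\omega\to2^\omega$ such that for every $A\in2^\omega$, every correct answer to $g(k(A))\lesssim_\delta q$ is a correct answer to $f(A)\lesssim_\varepsilon p$. *)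

(* Defs.v *)
From Stdlib Require Import Reals QArith Qreals ClassicalEpsilon.
Open Scope R_scope.

Definition cantor := nat -> bool.

Definition agree (x y : cantor) (n : nat) : Prop :=
  forall i, (i < n)%nat -> x i = y i.

Definition is_open (U : cantor -> Prop) : Prop :=
  forall x, U x -> exists n, forall y, agree x y n -> U y.

Definition cont_real (f : cantor -> R) : Prop :=
  forall x eps, 0 < eps -> exists n, forall y, agree x y n -> Rabs (f y - f x) < eps.

Definition cont_cantor (k : cantor -> cantor) : Prop :=
  forall x n, exists m, forall y, agree x y m -> agree (k x) (k y) n.

Definition baire1 (f : cantor -> R) : Prop :=
  exists fs : nat -> cantor -> R,
    (forall n, cont_real (fs n)) /\ forall x, Un_cv (fun n => fs n x) (f x).

(** Countable ordinals as Brouwer trees, with the usual (cumulative) order. *)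
Inductive Ord : Type :=
| OZ : Ord
| OS : Ord -> Ord
| OL : (nat -> Ord) -> Ord.

Fixpoint ord_le (a b : Ord) {struct a} : Prop :=
  match a with
  | OZ => True
  | OS a' =>
      (fix lt_b (b : Ord) : Prop :=
         match b with
         | OZ => False
         | OS b' => ord_le a' b'
         | OL g => exists n, lt_b (g n)
         end) b
  | OL h => forall n, ord_le (h n) b
  end.

Definition ord_lt (a b : Ord) : Prop := ord_le (OS a) b.
Definition ord_eq (a b : Ord) : Prop := ord_le a b /\ ord_le b a.
Definition ord_limit (a : Ord) : Prop :=
  ord_lt OZ a /\ forall b, ~ ord_eq a (OS b).

Definition deriv (C : (cantor -> Prop) -> Prop) (P : cantor -> Prop) : cantor -> Prop :=
  fun x => P x /\
    ~ (exists (U C0 : cantor -> Prop),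
         is_open U /\ U x /\ C C0 /\ (forall y, P y -> U y -> C0 y)).

Fixpoint opt_deriv (C : (cantor -> Prop) -> Prop) (a : Ord) : cantor -> Prop :=
  match a with
  | OZ => fun _ => True
  | OS b => deriv C (opt_deriv C b)
  | OL h => fun x => forall n, opt_deriv C (h n) x
  end.

Definition is_empty (P : cantor -> Prop) : Prop := forall x, ~ P x.

Definition bourgain_family (f : cantor -> R) (p e : Q) : (cantor -> Prop) -> Prop :=
  fun C0 => C0 = (fun x => f x < Q2R p + Q2R e) \/
            C0 = (fun x => Q2R p - Q2R e < f x).

Definition P_seq (f : cantor -> R) (p e : Q) (a : Ord) : cantor -> Prop :=
  opt_deriv (bourgain_family f p e) a.

Definition alpha (f : cantor -> R) (p e : Q) : Ord :=
  epsilon (inhabits OZ)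
    (fun a => is_empty (P_seq f p e a) /\
              forall b, is_empty (P_seq f p e b) -> ord_le a b).

Definition rank (f : cantor -> R) : Ord :=
  epsilon (inhabits OZ)
    (fun r => (forall p e, (0 < e)%Q -> ord_le (alpha f p e) r) /\
              forall r', (forall p e, (0 < e)%Q -> ord_le (alpha f p e) r') ->
                         ord_le r r').

Definition maximal (f : cantor -> R) (p e : Q) (nu : Ord) : Prop :=
  (0 < e)%Q /\ ord_eq (alpha f p e) (OS nu) /\
  exists x, P_seq f p e nu x /\ ~ (Q2R p - Q2R e < f x < Q2R p + Q2R e).

Definition two_sided (f : cantor -> R) : Prop :=
  exists nu, ord_eq (rank f) (OS nu) /\
    exists p e, maximal f p e nu /\
      (exists x, P_seq f p e nu x /\ ~ (Q2R p - Q2R e < f x)) /\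
      (exists x, P_seq f p e nu x /\ ~ (f x < Q2R p + Q2R e)).

Definition one_sided (f : cantor -> R) : Prop := ~ two_sided f.

Definition left_sided (f : cantor -> R) : Prop :=
  exists nu, ord_eq (rank f) (OS nu) /\
    forall p e, maximal f p e nu ->
      forall x, P_seq f p e nu x -> f x < Q2R p + Q2R e.

Definition right_sided (f : cantor -> R) : Prop :=
  exists nu, ord_eq (rank f) (OS nu) /\
    forall p e, maximal f p e nu ->
      forall x, P_seq f p e nu x -> Q2R p - Q2R e < f x.

Definition correct_answer (b : bool) (y : R) (p e : Q) : Prop :=
  (b = true /\ y < Q2R p + Q2R e) \/ (b = false /\ y > Q2R p - Q2R e).

Definition m_le (f g : cantor -> R) : Prop :=
  forall p e, (0 < e)%Q ->
    exists q d, (0 < d)%Q /\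
      exists k, cont_cantor k /\
        forall A b, correct_answer b (g (k A)) q d -> correct_answer b (f A) p e.

(* Main.v *)
Require Import Defs.
From Stdlib Require Import Reals QArith Qreals ClassicalEpsilon.
From Stdlib Require Import Classical FunctionalExtensionality Lra Lia Wf_nat.
From Stdlib Require Cantor.
Local Open Scope R_scope.

(* With A = {f >= p + e} and B = {f <= p - e}, the derivative of P is the set of
   points all of whose neighbourhoods meet both P /\ A and P /\ B, and f <=_m g
   says that every pair (A, B) of f is mapped continuously, A into A' and B into
   B', to some pair (A', B') of g.  Such a map sends the a-th derived set of f
   into that of g, so sidedness at the last nonempty level is an obstruction.
   Conversely a map is built by induction on the level: on the derived set P^a a
   point y of P'^a of the required kind serves as constant value, and off P^a
   one works on cylinders missing P^a, whose reductions into smaller and smaller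
   neighbourhoods of y exist by induction; where the next derived set vanishes,
   each point has a neighbourhood in which P^a misses A or B, so y in B' or y in
   A' is good enough there. *)

(** * Countable ordinals *)

Lemma ord_le_lim (a : Ord) (h : nat -> Ord) (n : nat) :
  ord_le a (h n) -> ord_le a (OL h).
Proof.
  revert h n; induction a as [|a IH|k IH]; intros h n H; simpl in *.
  - exact I.
  - exists n; exact H.
  - intros m; apply IH with n; apply H.
Qed.

Lemma ord_le_refl (a : Ord) : ord_le a a.
Proof.
  induction a as [|a IH|k IH]; simpl; auto.
  intros n; apply ord_le_lim with n; apply IH.
Qed.

Lemma ord_le_trans (a b c : Ord) : ord_le a b -> ord_le b c -> ord_le a c.
Proof.
  revert b c; induction a as [|a IHa|h IHa].
  - intros; exact I.
  - induction b as [|b IHb|g IHb].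
    + intros c [].
    + intros c Hab; induction c as [|c IHc|g IHc].
      * intros [].
      * exact (IHa b c Hab).
      * intros [n Hn]; exists n; exact (IHc n Hn).
    + intros c [n Hn] Hg; exact (IHb n c Hn (Hg n)).
  - intros b c H Hbc n; exact (IHa n b c (H n) Hbc).
Qed.

Lemma ord_le_succ (a : Ord) : ord_le a (OS a).
Proof.
  induction a as [|a IH|h IH].
  - exact I.
  - exact IH.
  - intros n; apply ord_le_trans with (1 := IH n).
    change (ord_le (h n) (OL h)); apply ord_le_lim with n; apply ord_le_refl.
Qed.

Lemma ord_le_or_lt (a b : Ord) : ord_le a b \/ ord_lt b a.
Proof.
  revert b; induction a as [|a IHa|h IHa]; intros b.
  - left; exact I.
  - induction b as [|b IHb|g IHb].
    + right; exact I.
    + destruct (IHa b) as [H|H]; [left|right]; exact H.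
    + destruct (classic (exists n, ord_le (OS a) (g n))) as [H|H].
      * left; exact H.
      * right; intros n; destruct (IHb n) as [Hn|Hn]; [|exact Hn].
        destruct H; exists n; exact Hn.
  - destruct (classic (forall n, ord_le (h n) b)) as [H|H].
    + left; exact H.
    + right; apply not_all_ex_not in H; destruct H as [n Hn].
      destruct (IHa n b) as [H|H]; [contradiction|].
      exists n; exact H.
Qed.

(** Structural induction on trees suffices: by computation, [b] below [OS a] means [ord_le b a], and
    [b] below a limit means [b] below one of its members. *)
Lemma ord_lt_wf : well_founded ord_lt.
Proof.
  intros a; induction a as [|a IH|h IH].
  - constructor; intros b [].
  - constructor; intros b Hb; constructor; intros c Hc.
    apply (Acc_inv IH); exact (ord_le_trans _ _ _ Hc Hb).
  - constructor; intros b [n Hn]; exact (Acc_inv (IH n) Hn).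
Qed.

Lemma ord_least (S : Ord -> Prop) :
  (exists a, S a) -> exists a, S a /\ forall b, S b -> ord_le a b.
Proof.
  intros [a Ha]; apply NNPP; intros H.
  revert Ha; induction (ord_lt_wf a) as [a _ IH]; intros Ha.
  apply H; exists a; split; [exact Ha|]; intros b Hb.
  destruct (ord_le_or_lt a b) as [Hab|Hab]; [exact Hab|].
  destruct (IH b Hab Hb).
Qed.

(** * Topology of Cantor space *)

Lemma agree_refl x n : agree x x n.
Proof. intros i _; reflexivity. Qed.

Lemma agree_sym x y n : agree x y n -> agree y x n.
Proof. intros H i Hi; symmetry; auto. Qed.

Lemma agree_trans x y z n : agree x y n -> agree y z n -> agree x z n.
Proof. intros H K i Hi; rewrite H, K; auto. Qed.

Lemma agree_mono x y n m : (m <= n)%nat -> agree x y n -> agree x y m.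
Proof. intros H K i Hi; apply K; lia. Qed.

Definition is_closed (P : cantor -> Prop) : Prop := is_open (fun x => ~ P x).

Lemma cylinder_open x n : is_open (fun y => agree x y n).
Proof. intros y H; exists n; intros z; apply agree_trans; exact H. Qed.

Lemma is_closed_limit (P : cantor -> Prop) x :
  is_closed P -> (forall n, exists z, P z /\ agree x z n) -> P x.
Proof.
  intros HP H; apply NNPP; intros Hx.
  destruct (HP x Hx) as [n Hn]; destruct (H n) as [z [Hz Hxz]].
  exact (Hn z Hxz Hz).
Qed.

(** Dependent choice along shrinking cylinders, shared by the compactness and the Baire category
    arguments. [D i s n] is the demand at stage [i] on the cylinder of length [n] around [s]. *)
Lemma nested_cylinders (D : nat -> cantor -> nat -> Prop) s0 n0 :
  D 0%nat s0 n0 ->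
  (forall i s n, D i s n ->
     exists s' n', (n < n')%nat /\ agree s s' n /\ D (S i) s' n') ->
  exists x, forall i, exists s n, (i <= n)%nat /\ agree s x n /\ D i s n.
Proof.
  intros H0 Hstep.
  destruct (choice (fun (t t' : nat * (cantor * nat)) =>
    D (fst t) (fst (snd t)) (snd (snd t)) ->
    fst t' = S (fst t) /\ (snd (snd t) < snd (snd t'))%nat /\
    agree (fst (snd t)) (fst (snd t')) (snd (snd t)) /\
    D (fst t') (fst (snd t')) (snd (snd t')))) as [F HF].
  { intros [i [s n]]; simpl.
    destruct (classic (D i s n)) as [H|H].
    - destruct (Hstep i s n H) as [s' [n' H']].
      exists (S i, (s', n')); simpl; tauto.
    - exists (i, (s, n)); tauto. }
  pose (T := fix T i := match i with 0%nat => (0%nat, (s0, n0)) | S j => F (T j) end).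
  assert (HT : forall i, fst (T i) = i /\ D i (fst (snd (T i))) (snd (snd (T i)))).
  { induction i as [|i [E H]]; [split; [reflexivity|exact H0]|].
    rewrite <- E in H at 1; destruct (HF (T i) H) as [E' [_ [_ H']]].
    rewrite E in E'; split; [exact E'|].
    change (T (S i)) with (F (T i)); rewrite <- E' at 1; exact H'. }
  pose (s := fun i => fst (snd (T i))); pose (l := fun i => snd (snd (T i))).
  assert (Hs : forall i, (l i < l (S i))%nat /\ agree (s i) (s (S i)) (l i)).
  { intros i; destruct (HT i) as [E H]; rewrite <- E in H at 1.
    destruct (HF (T i) H) as [_ [H1 [H2 _]]]; split; assumption. }
  assert (Hl : forall i, (i <= l i)%nat).
  { induction i as [|i IH]; [lia|]; destruct (Hs i); lia. }
  assert (Hd : forall d i, (l i <= l (i + d))%nat /\ agree (s i) (s (i + d)%nat) (l i)).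
  { induction d as [|d IH]; intros i.
    - rewrite Nat.add_0_r; split; [lia|apply agree_refl].
    - rewrite Nat.add_succ_r; destruct (IH i) as [H1 H2], (Hs (i + d)%nat) as [H3 H4].
      split; [lia|]; apply agree_trans with (1 := H2).
      apply agree_mono with (2 := H4); exact H1. }
  (* Bit [j] is final from stage [S j] on, since [l (S j)] exceeds [j]. *)
  exists (fun j => s (S j) j); intros i; exists (s i), (l i); split; [apply Hl|].
  split; [|apply (HT i)].
  intros j Hj; destruct (Nat.le_ge_cases i (S j)) as [H|H].
  - replace (S j) with (i + (S j - i))%nat by lia.
    apply (proj2 (Hd (S j - i)%nat i)); exact Hj.
  - replace i with (S j + (i - S j))%nat at 1 by lia.
    symmetry; apply (proj2 (Hd (i - S j)%nat (S j))).
    specialize (Hl (S j)); lia.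
Qed.

(** A number codes a pair (a, n), which stands for the cylinder of length n around the binary digits
    of a. A countable base keeps suprema of stages within Brouwer trees. *)
Definition basic_seq (c : nat) : cantor := Nat.testbit (fst (Cantor.of_nat c)).
Definition basic_len (c : nat) : nat := snd (Cantor.of_nat c).

Lemma basic_surj x n : exists c, basic_len c = n /\ agree (basic_seq c) x n.
Proof.
  assert (H : exists a, agree (Nat.testbit a) x n).
  { induction n as [|n [a Ha]].
    - exists 0%nat; intros i Hi; lia.
    - exists (if x n then Nat.setbit a n else Nat.clearbit a n); intros i Hi.
      destruct (Nat.eq_dec i n) as [->|E].
      + destruct (x n); [apply Nat.setbit_eq|apply Nat.clearbit_eq].
      + rewrite <- (Ha i) by lia.
        destruct (x n); [apply Nat.setbit_neq|apply Nat.clearbit_neq]; auto. }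
  destruct H as [a Ha]; exists (Cantor.to_nat (a, n)).
  unfold basic_seq, basic_len; rewrite Cantor.cancel_of_to; auto.
Qed.

(** * Derivation sequences of pairs of sets *)

Definition pair_deriv (A B P : cantor -> Prop) : cantor -> Prop :=
  fun x => P x /\ forall n,
    (exists z, agree x z n /\ P z /\ A z) /\ (exists z, agree x z n /\ P z /\ B z).

Fixpoint pair_seq (A B : cantor -> Prop) (a : Ord) : cantor -> Prop :=
  match a with
  | OZ => fun _ => True
  | OS b => pair_deriv A B (pair_seq A B b)
  | OL h => fun x => forall n, pair_seq A B (h n) x
  end.

Section PairSeq.
Variables A B : cantor -> Prop.

Lemma pair_seq_closed (a : Ord) : is_closed (pair_seq A B a).
Proof.
  induction a as [|a IH|h IH]; intros x Hx.
  - destruct Hx; exact I.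
  - destruct (classic (pair_seq A B a x)) as [Ha|Ha].
    + simpl in Hx; unfold pair_deriv in Hx.
      assert (H : ~ forall n,
        (exists z, agree x z n /\ pair_seq A B a z /\ A z) /\
        (exists z, agree x z n /\ pair_seq A B a z /\ B z)) by tauto.
      apply not_all_ex_not in H; destruct H as [n Hn].
      exists n; intros y Hxy [_ Hy]; apply Hn.
      destruct (Hy n) as [[u [Hu Hu']] [v [Hv Hv']]].
      split; [exists u|exists v]; split; auto; eapply agree_trans; eauto.
    + destruct (IH x Ha) as [n Hn]; exists n; intros y Hxy [Hy _].
      exact (Hn y Hxy Hy).
  - apply not_all_ex_not in Hx; destruct Hx as [i Hi].
    destruct (IH i x Hi) as [n Hn]; exists n; intros y Hxy Hy.
    exact (Hn y Hxy (Hy i)).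
Qed.

Lemma pair_seq_anti (a b : Ord) :
  ord_le a b -> forall x, pair_seq A B b x -> pair_seq A B a x.
Proof.
  revert b; induction a as [|a IHa|h IHa].
  - intros; exact I.
  - induction b as [|b IHb|g IHb].
    + intros [].
    + intros H x [Hx K]; split; [exact (IHa b H x Hx)|].
      intros n; destruct (K n) as [[u [Hu [Hu1 Hu2]]] [v [Hv [Hv1 Hv2]]]].
      split; [exists u|exists v]; repeat split; auto; apply (IHa b H); assumption.
    + intros [n Hn] x Hx; exact (IHb n Hn x (Hx n)).
  - intros b H x Hx n; exact (IHa n b (H n) x Hx).
Qed.

(** For each basic cylinder choose a stage that misses it, if any does. The supremum of these
    countably many stages misses every basic cylinder that is ever missed, so the next derivative
    removes nothing. *)
Lemma pair_seq_stabilizes :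
  exists a, forall x, pair_seq A B a x -> pair_seq A B (OS a) x.
Proof.
  pose (misses := fun c a => forall z, agree (basic_seq c) z (basic_len c) -> ~ pair_seq A B a z).
  destruct (choice (fun c a => (exists b, misses c b) -> misses c a)) as [h Hh].
  { intros c; destruct (classic (exists b, misses c b)) as [[b Hb]|H].
    - exists b; auto.
    - exists OZ; tauto. }
  exists (OL h); intros x Hx; apply NNPP; intros Hn.
  destruct (pair_seq_closed _ x Hn) as [n Hn'].
  destruct (basic_surj x n) as [c [Ec Hc]].
  assert (Hm : misses c (OS (OL h))).
  { intros z Hz; rewrite Ec in Hz; apply Hn'.
    apply agree_trans with (2 := Hz); apply agree_sym; exact Hc. }
  apply (Hh c (ex_intro _ _ Hm) x); [rewrite Ec; exact Hc|exact (Hx c)].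
Qed.

(** Compactness by bisection: if no stage [h n] is empty, one half of a cylinder meeting all of them
    again meets all of them, and the limit point lies in each stage because stages are closed. *)
Lemma pair_seq_compact (h : nat -> Ord) :
  is_empty (pair_seq A B (OL h)) -> exists n, is_empty (pair_seq A B (h n)).
Proof.
  intros H; apply NNPP; intros K.
  assert (K' : forall j, exists z, pair_seq A B (h j) z).
  { intros j; apply NNPP; intros L; apply K; exists j; intros z Hz; apply L; eauto. }
  destruct (nested_cylinders
    (fun _ s n => forall j, exists z, pair_seq A B (h j) z /\ agree s z n)
    (fun _ => true) 0%nat) as [x Hx].
  - intros j; destruct (K' j) as [z Hz]; exists z; split; [exact Hz|intros i Hi; lia].
  - intros _ s n Hs.
    pose (s' := fun (b : bool) i => if Nat.eqb i n then b else s i).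
    assert (Hb : exists b, forall j, exists z, pair_seq A B (h j) z /\ agree (s' b) z (S n)).
    { apply NNPP; intros L.
      assert (L' : forall b, exists j, forall z, pair_seq A B (h j) z -> ~ agree (s' b) z (S n)).
      { intros b; apply NNPP; intros L'; apply L; exists b; intros j.
        apply NNPP; intros L''; apply L'; exists j; intros z Hz Ha; apply L''; eauto. }
      (* [h] need not be increasing, but any two ordinals are comparable: the later of the two
         stages misses both halves. *)
      assert (Lmax : exists j, forall b z, pair_seq A B (h j) z -> ~ agree (s' b) z (S n)).
      { destruct (L' true) as [i Hi], (L' false) as [j Hj].
        destruct (ord_le_or_lt (h i) (h j)) as [Hij|Hij].
        - exists j; intros [|] z Hz; [apply Hi|apply Hj; exact Hz].
          apply (pair_seq_anti _ _ Hij); exact Hz.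
        - exists i; intros [|] z Hz; [apply Hi; exact Hz|apply Hj].
          apply (pair_seq_anti (h j) (h i)); [|exact Hz].
          exact (ord_le_trans _ _ _ (ord_le_succ _) Hij). }
      destruct Lmax as [j Hj], (Hs j) as [z [Hz Hsz]].
      apply (Hj (z n) z Hz); intros i Hi; unfold s'.
      destruct (Nat.eqb_spec i n) as [->|E]; [reflexivity|apply Hsz; lia]. }
    destruct Hb as [b Hb]; exists (s' b), (S n); split; [lia|]; split; [|exact Hb].
    intros i Hi; unfold s'; destruct (Nat.eqb_spec i n); [lia|reflexivity].
  - apply (H x); intros j; apply (is_closed_limit _ x (pair_seq_closed (h j))); intros i.
    destruct (Hx i) as [s [n [Hn [Hsx HD]]]], (HD j) as [z [Hz Hsz]].
    exists z; split; [exact Hz|]; apply agree_mono with (1 := Hn).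
    apply agree_trans with (2 := Hsz); apply agree_sym; exact Hsx.
Qed.

(** Stage zero is the whole space, hence not empty, and at a limit compactness passes to an empty
    earlier stage; the descent ends at a successor. *)
Lemma pair_seq_empty_succ (a : Ord) :
  is_empty (pair_seq A B a) -> exists m, ord_le (OS m) a /\ is_empty (pair_seq A B (OS m)).
Proof.
  induction a as [|a IH|h IH]; intros H.
  - destruct (H (fun _ => true)); exact I.
  - exists a; split; [apply ord_le_refl|exact H].
  - destruct (pair_seq_compact h H) as [n Hn], (IH n Hn) as [m [Hm Hm']].
    exists m; split; [exact (ord_le_lim _ h n Hm)|exact Hm'].
Qed.

End PairSeq.

(** * Reductions between pairs of sets *)

Section Reduction.
Variables A B A' B' : cantor -> Prop.

Definition cont_at (k : cantor -> cantor) (x : cantor) : Prop :=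
  forall n, exists m, forall y, agree x y m -> agree (k x) (k y) n.

(** [k] is total but constrained only on the cylinder. Continuity is asked pointwise and, the
    cylinder being open, does not see the values outside. *)
Definition reduces_into (s : cantor) (n : nat) (W : cantor -> Prop) : Prop :=
  exists k, forall x, agree s x n ->
    cont_at k x /\ W (k x) /\ (A x -> A' (k x)) /\ (B x -> B' (k x)).

Lemma reduces_into_restrict s n s' n' (W W' : cantor -> Prop) :
  (n <= n')%nat -> agree s s' n -> (forall z, W z -> W' z) ->
  reduces_into s n W -> reduces_into s' n' W'.
Proof.
  intros Hn Hs HW [k Hk]; exists k; intros x Hx.
  destruct (Hk x) as [H1 [H2 H3]]; [|auto].
  apply agree_trans with (1 := Hs); apply agree_mono with (2 := Hx); exact Hn.
Qed.

(** A canonical centre for each cylinder, so that choices made at [truncate x n] depend on the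
    cylinder alone. *)
Definition truncate (x : cantor) (n : nat) : cantor :=
  fun i => if Nat.ltb i n then x i else false.

Lemma truncate_agree x n : agree (truncate x n) x n.
Proof.
  intros i Hi; unfold truncate; destruct (Nat.ltb_spec i n); [reflexivity|lia].
Qed.

Lemma truncate_eq x y n : agree x y n -> truncate x n = truncate y n.
Proof.
  intros H; apply functional_extensionality; intros i; unfold truncate.
  destruct (Nat.ltb_spec i n); auto.
Qed.

(* On the closed set [P] the glued map is constantly [y]; off [P] it uses the
   local reduction of the largest cylinder that has one and misses [P], and
   these cylinders shrink near [P], where [V n] shrinks to [y]. *)
Lemma reduces_into_glue (P : cantor -> Prop) (y : cantor) s n
    (V : nat -> cantor -> Prop) (W : cantor -> Prop) :
  is_closed P ->
  (forall x, agree s x n -> P x -> W y /\ (A x -> A' y) /\ (B x -> B' y)) ->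
  (forall x, P x -> forall j z, V j z -> agree y z j) ->
  (forall j z, V j z -> W z) ->
  (forall x, agree s x n -> ~ P x ->
     exists j0, forall j, (j0 <= j)%nat -> reduces_into x j (V j)) ->
  reduces_into s n W.
Proof.
  intros HP Hon HVy HVW Hoff.
  pose (Q := fun x j => (forall z, agree x z j -> ~ P z) /\ reduces_into x j (V j)).
  assert (HQ : forall x x' j, agree x x' j -> Q x j -> Q x' j).
  { intros x x' j Hx [H1 H2]; split.
    - intros z Hz; apply H1; apply agree_trans with (1 := Hx); exact Hz.
    - apply reduces_into_restrict with x j (V j); auto. }
  (* [l x] is the least admissible length, which makes it locally constant off [P]. *)
  destruct (choice (fun x j => agree s x n -> ~ P x -> Q x j /\
     forall i, (i < j)%nat -> ~ Q x i)) as [l Hl].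
  { intros x; destruct (classic (agree s x n /\ ~ P x)) as [[Hx HPx]|H];
      [|exists 0%nat; tauto].
    assert (Hex : exists j, Q x j).
    { destruct (Hoff x Hx HPx) as [j0 Hj0], (HP x HPx) as [j1 Hj1].
      exists (Nat.max j0 j1); split.
      - intros z Hz; apply Hj1; apply agree_mono with (2 := Hz); lia.
      - apply Hj0; lia. }
    destruct Hex as [j Hj]; induction j as [j IH] using lt_wf_ind.
    destruct (classic (exists i, (i < j)%nat /\ Q x i)) as [[i [Hi Hi']]|H].
    - exact (IH i Hi Hi').
    - exists j; intros _ _; split; [exact Hj|]; intros i Hi Hi'; apply H; eauto. }
  destruct (choice (fun (t : cantor * nat) k => Q (fst t) (snd t) ->
     forall x, agree (fst t) x (snd t) ->
     cont_at k x /\ V (snd t) (k x) /\ (A x -> A' (k x)) /\ (B x -> B' (k x))))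
     as [K HK].
  { intros [x j]; simpl; destruct (classic (Q x j)) as [[_ [k Hk]]|H].
    - exists k; auto.
    - exists (fun z => z); tauto. }
  pose (k := fun x => if excluded_middle_informative (P x) then y
                      else K (truncate x (l x), l x) x).
  assert (HkP : forall x, P x -> k x = y).
  { intros x Hx; unfold k; destruct (excluded_middle_informative (P x)); tauto. }
  assert (HkN : forall x, ~ P x -> k x = K (truncate x (l x), l x) x).
  { intros x Hx; unfold k; destruct (excluded_middle_informative (P x)); tauto. }
  assert (HKx : forall x, agree s x n -> ~ P x ->
     cont_at (K (truncate x (l x), l x)) x /\ V (l x) (k x) /\
     (A x -> A' (k x)) /\ (B x -> B' (k x))).
  { intros x Hx HPx; rewrite (HkN x HPx).
    apply (HK (truncate x (l x), l x)); simpl; [|apply truncate_agree].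
    apply HQ with x; [apply agree_sym, truncate_agree|apply (Hl x Hx HPx)]. }
  exists k; intros x Hx; destruct (classic (P x)) as [HPx|HPx].
  (* Continuity on [P]: if [x'] off [P] agrees with [x] up to [N], its cylinder of length [l x']
     misses [x], so [l x'] is at least [N] and the value agrees with [y] that far. *)
  - destruct (Hon x Hx HPx) as [HW HAB]; rewrite (HkP x HPx).
    split; [|split; assumption].
    intros N; exists (Nat.max n N); intros x' Hx'; rewrite (HkP x HPx).
    destruct (classic (P x')) as [HPx'|HPx']; [rewrite (HkP x' HPx'); apply agree_refl|].
    assert (Hsx' : agree s x' n).
    { apply agree_trans with (1 := Hx); apply agree_mono with (2 := Hx'); lia. }
    destruct (HKx x' Hsx' HPx') as [_ [HV _]].
    apply agree_mono with (l x'); [|exact (HVy x HPx _ _ HV)].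
    destruct (Nat.le_gt_cases N (l x')) as [H|H]; [exact H|].
    destruct (Hl x' Hsx' HPx') as [[Hmiss _] _].
    destruct (Hmiss x); [|exact HPx].
    apply agree_sym; apply agree_mono with (2 := Hx'); lia.
  - destruct (HKx x Hx HPx) as [Hc [HV HAB]].
    split; [|split; [exact (HVW _ _ HV)|exact HAB]].
    intros N; destruct (Hc N) as [M HM].
    exists (Nat.max M (Nat.max n (l x))); intros x' Hx'.
    assert (Hsx' : agree s x' n).
    { apply agree_trans with (1 := Hx); apply agree_mono with (2 := Hx'); lia. }
    assert (Hlx : agree x x' (l x)) by (apply agree_mono with (2 := Hx'); lia).
    destruct (Hl x Hx HPx) as [Hq Hmin].
    assert (HPx' : ~ P x') by (apply (proj1 Hq); exact Hlx).
    destruct (Hl x' Hsx' HPx') as [Hq' Hmin'].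
    (* Admissibility of the shorter length passes between [x] and [x'], against the minimality of
       the longer one. *)
    assert (E : l x' = l x).
    { destruct (Nat.lt_trichotomy (l x) (l x')) as [H|[H|H]]; [|auto|].
      - destruct (Hmin' (l x) H); exact (HQ _ _ _ Hlx Hq).
      - destruct (Hmin (l x') H); apply HQ with x'; [|exact Hq'].
        apply agree_sym; apply agree_mono with (2 := Hlx); lia. }
    rewrite (HkN x HPx), (HkN x' HPx'), E.
    rewrite <- (truncate_eq x x' (l x) Hlx).
    apply HM; apply agree_mono with (2 := Hx'); lia.
Qed.

(** The induction claim. It asks for arbitrarily small cylinders around [y] because gluing at [y]
    needs local reductions that shrink to it. *)
Definition reduces_below (a : Ord) : Prop :=
  forall s n y m, (forall x, agree s x n -> ~ pair_seq A B a x) ->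
    pair_seq A' B' a y -> reduces_into s n (fun z => agree y z m).

Lemma reduces_to_point (a : Ord) s n y m :
  reduces_below a -> pair_seq A' B' a y ->
  (forall x, agree s x n -> pair_seq A B a x -> (A x -> A' y) /\ (B x -> B' y)) ->
  reduces_into s n (fun z => agree y z m).
Proof.
  intros Ha Hy H.
  apply reduces_into_glue with (P := pair_seq A B a) (y := y)
    (V := fun j z => agree y z (Nat.max m j)).
  - apply pair_seq_closed.
  - intros x Hx HP; split; [apply agree_refl|auto].
  - intros _ _ j z Hz; apply agree_mono with (2 := Hz); lia.
  - intros j z Hz; apply agree_mono with (2 := Hz); lia.
  - intros x Hx HP; destruct (pair_seq_closed A B a x HP) as [j0 Hj0].
    exists j0; intros j Hj; apply Ha; [|exact Hy].
    intros z Hz; apply Hj0; apply agree_mono with (2 := Hz); exact Hj.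
Qed.

Lemma reduces_to_two_points (a : Ord) s n (W : cantor -> Prop) ya yb :
  reduces_below a -> is_open W ->
  W ya -> pair_seq A' B' a ya -> A' ya ->
  W yb -> pair_seq A' B' a yb -> B' yb ->
  (forall x, agree s x n -> ~ pair_seq A B (OS a) x) -> reduces_into s n W.
Proof.
  intros Ha HW Wa Pa A'a Wb Pb B'b H.
  apply reduces_into_glue with (P := fun _ => False) (y := ya) (V := fun _ => W);
    try tauto.
  - intros x _; exists 0%nat; tauto.
  - intros x Hx _.
    assert (Hdec : exists j0,
      (forall z, agree x z j0 -> pair_seq A B a z -> ~ A z) \/
      (forall z, agree x z j0 -> pair_seq A B a z -> ~ B z)).
    { apply NNPP; intros L; apply (H x Hx); split.
      - apply (is_closed_limit _ x (pair_seq_closed A B a)); intros j.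
        apply NNPP; intros K; apply L; exists j; left; intros z Hz Pz _; apply K; eauto.
      - intros j; split; apply NNPP; intros K; apply L; exists j; [left|right];
          intros z Hz Pz Sz; apply K; eauto. }
    destruct Hdec as [j0 Hdec]; exists j0; intros j Hj.
    destruct Hdec as [Hdec|Hdec].
    + destruct (HW yb Wb) as [m Hm].
      apply reduces_into_restrict with x j (fun z => agree yb z m);
        [lia|apply agree_refl|exact Hm|].
      apply reduces_to_point with a; auto; intros z Hz Pz; split; [|auto].
      intros Az; destruct (Hdec z); auto; apply agree_mono with (2 := Hz); exact Hj.
    + destruct (HW ya Wa) as [m Hm].
      apply reduces_into_restrict with x j (fun z => agree ya z m);
        [lia|apply agree_refl|exact Hm|].
      apply reduces_to_point with a; auto; intros z Hz Pz; split; [auto|].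
      intros Bz; destruct (Hdec z); auto; apply agree_mono with (2 := Hz); exact Hj.
Qed.

(** At zero the hypothesis is contradictory. At a successor, [y] lying in the derivative supplies
    two target points inside the cylinder. At a limit, each point has left some earlier stage, and
    the local reductions are patched by gluing along the empty set. *)
Lemma reduces_below_all (a : Ord) : reduces_below a.
Proof.
  induction a as [|a IH|h IH]; intros s n y m H Hy.
  - destruct (H s); [apply agree_refl|exact I].
  - destruct Hy as [_ Hy]; destruct (Hy m) as [[ya [Wa [Pa A'a]]] [yb [Wb [Pb B'b]]]].
    apply reduces_to_two_points with a ya yb; auto using cylinder_open.
  - apply reduces_into_glue with (P := fun _ => False) (y := y)
      (V := fun _ z => agree y z m); try tauto.
    + intros x _; exists 0%nat; tauto.
    + intros x Hx _; specialize (H x Hx); apply not_all_ex_not in H.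
      destruct H as [i Hi], (pair_seq_closed A B (h i) x Hi) as [j0 Hj0].
      exists j0; intros j Hj; apply (IH i); [|apply Hy].
      intros z Hz; apply Hj0; apply agree_mono with (2 := Hz); exact Hj.
Qed.

Definition pair_le : Prop :=
  exists k, cont_cantor k /\ forall x, (A x -> A' (k x)) /\ (B x -> B' (k x)).

Lemma pair_le_of_reduces_into W : reduces_into (fun _ => true) 0 W -> pair_le.
Proof.
  intros [k Hk].
  assert (H0 : forall x, agree (fun _ => true) x 0) by (intros x i Hi; lia).
  exists k; split; [intros x|intros x]; apply (Hk x (H0 x)).
Qed.

Lemma pair_le_empty (a : Ord) y :
  is_empty (pair_seq A B a) -> pair_seq A' B' a y -> pair_le.
Proof.
  intros H Hy; apply pair_le_of_reduces_into with (fun z => agree y z 0).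
  apply reduces_below_all with a; auto.
Qed.

Lemma pair_le_point (a : Ord) y :
  pair_seq A' B' a y ->
  (forall x, pair_seq A B a x -> (A x -> A' y) /\ (B x -> B' y)) -> pair_le.
Proof.
  intros Hy H; apply pair_le_of_reduces_into with (fun z => agree y z 0).
  apply reduces_to_point with a; auto using reduces_below_all.
Qed.

Lemma pair_le_two_points (a : Ord) ya yb :
  pair_seq A' B' a ya -> A' ya -> pair_seq A' B' a yb -> B' yb ->
  is_empty (pair_seq A B (OS a)) -> pair_le.
Proof.
  intros; apply pair_le_of_reduces_into with (fun _ => True).
  apply reduces_to_two_points with a ya yb; auto using reduces_below_all.
  intros x _; exists 0%nat; auto.
Qed.

(** Continuity carries witnesses near [x] to witnesses near [k x]. Besides being the obstruction to
    reducibility, this compares the stages of nested pairs when [k] is the identity. *)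
Lemma pair_seq_image k (a : Ord) :
  cont_cantor k -> (forall x, (A x -> A' (k x)) /\ (B x -> B' (k x))) ->
  forall x, pair_seq A B a x -> pair_seq A' B' a (k x).
Proof.
  intros Hc Hk; induction a as [|a IH|h IH]; intros x Hx.
  - exact I.
  - destruct Hx as [Hx Hn]; split; [auto|]; intros n.
    destruct (Hc x n) as [m Hm], (Hn m) as [[u [Hu [Pu Au]]] [v [Hv [Pv Bv]]]].
    split; [exists (k u)|exists (k v)]; repeat split; auto; apply Hk; assumption.
  - intros n; apply IH; apply Hx.
Qed.

End Reduction.

(** * Bourgain rank *)

(** [hi] and [lo] are the complements of the two sets in [bourgain_family]: on [hi] the answer
    [true] is wrong, on [lo] the answer [false] is. *)
Definition hi (f : cantor -> R) (p e : Q) : cantor -> Prop :=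
  fun x => Q2R p + Q2R e <= f x.
Definition lo (f : cantor -> R) (p e : Q) : cantor -> Prop :=
  fun x => f x <= Q2R p - Q2R e.

(** Near [x], lying in a member of the family is the same as missing [hi] or [lo], and open
    neighbourhoods shrink to cylinders. *)
Lemma P_seq_pair_seq f p e a x :
  P_seq f p e a x <-> pair_seq (hi f p e) (lo f p e) a x.
Proof.
  unfold P_seq; revert x; induction a as [|a IH|h IH]; intros x; simpl.
  - tauto.
  - unfold deriv, pair_deriv; split.
    + intros [Hx H]; split; [apply IH; exact Hx|]; intros n.
      split; apply NNPP; intros K; apply H; exists (fun y => agree x y n).
      * exists (fun y => f y < Q2R p + Q2R e).
        split; [apply cylinder_open|split; [apply agree_refl|split; [left; reflexivity|]]].
        intros y Py Hy; apply Rnot_le_lt; intros L; apply K; exists y.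
        split; [exact Hy|split; [apply IH; exact Py|exact L]].
      * exists (fun y => Q2R p - Q2R e < f y).
        split; [apply cylinder_open|split; [apply agree_refl|split; [right; reflexivity|]]].
        intros y Py Hy; apply Rnot_le_lt; intros L; apply K; exists y.
        split; [exact Hy|split; [apply IH; exact Py|exact L]].
    + intros [Hx H]; split; [apply IH; exact Hx|].
      intros [U [C0 [HU [Ux [HC HUC]]]]].
      destruct (HU x Ux) as [n Hn], (H n) as [[u [Hu [Pu Au]]] [v [Hv [Pv Bv]]]].
      apply IH in Pu; apply IH in Pv; unfold hi in Au; unfold lo in Bv.
      destruct HC as [-> | ->].
      * specialize (HUC u Pu (Hn u Hu)); simpl in HUC; lra.
      * specialize (HUC v Pv (Hn v Hv)); simpl in HUC; lra.
  - split; intros H n; apply IH; apply H.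
Qed.

Lemma Q2R_pos e : (0 < e)%Q -> 0 < Q2R e.
Proof. intros H; apply Qlt_Rlt in H; unfold Q2R at 1 in H; simpl in H; lra. Qed.

Lemma cont_real_gt f x c : cont_real f -> c < f x ->
  exists n, forall y, agree x y n -> c < f y.
Proof.
  intros Hf H; destruct (Hf x (f x - c)) as [n Hn]; [lra|].
  exists n; intros y Hy; specialize (Hn y Hy); apply Rabs_def2 in Hn; lra.
Qed.

Lemma cont_real_lt f x c : cont_real f -> f x < c ->
  exists n, forall y, agree x y n -> f y < c.
Proof.
  intros Hf H; destruct (Hf x (c - f x)) as [n Hn]; [lra|].
  exists n; intros y Hy; specialize (Hn y Hy); apply Rabs_def2 in Hn; lra.
Qed.

(* Baire category: a perfect kernel would contain a point at which the
   approximating continuous functions are infinitely often above [p + e/2] and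
   infinitely often below [p - e/2]. *)
Lemma baire1_no_kernel f p e (P : cantor -> Prop) :
  baire1 f -> (0 < e)%Q -> is_closed P ->
  (forall x, P x -> pair_deriv (hi f p e) (lo f p e) P x) -> is_empty P.
Proof.
  intros [fs [Hc Hl]] He HP HD x0 Hx0; apply Q2R_pos in He.
  set (c := Q2R p) in *; set (d := Q2R e) in *.
  destruct (nested_cylinders
    (fun i s n => P s /\ match i with
       | 0%nat => True
       | S j =>
         (exists m, (j <= m)%nat /\ forall z, agree s z n -> c + d / 2 < fs m z) /\
         (exists m, (j <= m)%nat /\ forall z, agree s z n -> fs m z < c - d / 2)
       end) x0 0%nat) as [x Hx].
  - auto.
  - intros i s n [Ps _].
    (* First [u] in [hi], then [v] in [lo] so close to [u] that the bound valid near [u] persists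
       around [v], the next centre. *)
    destruct (HD s Ps) as [_ K], (K n) as [[u [Hu [Pu Au]]] _].
    unfold hi in Au; fold c d in Au.
    destruct (Hl u (d / 2)) as [N HN]; [lra|].
    specialize (HN (Nat.max N i) ltac:(lia)); apply Rabs_def2 in HN.
    destruct (cont_real_gt (fs (Nat.max N i)) u (c + d / 2) (Hc _)) as [n1 Hn1]; [lra|].
    destruct (HD u Pu) as [_ K'], (K' (Nat.max n n1)) as [_ [v [Hv [Pv Bv]]]].
    unfold lo in Bv; fold c d in Bv.
    destruct (Hl v (d / 2)) as [M HM]; [lra|].
    specialize (HM (Nat.max M i) ltac:(lia)); apply Rabs_def2 in HM.
    destruct (cont_real_lt (fs (Nat.max M i)) v (c - d / 2) (Hc _)) as [n2 Hn2]; [lra|].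
    exists v, (S (Nat.max (Nat.max n n1) n2)); split; [lia|]; split; [|split; [exact Pv|split]].
    + apply agree_trans with (1 := Hu); apply agree_mono with (2 := Hv); lia.
    + exists (Nat.max N i); split; [lia|]; intros z Hz; apply Hn1.
      apply agree_trans with v; [apply agree_mono with (2 := Hv); lia|].
      apply agree_mono with (2 := Hz); lia.
    + exists (Nat.max M i); split; [lia|]; intros z Hz; apply Hn2.
      apply agree_mono with (2 := Hz); lia.
  (* From index [N] on the values are within [d / 2] of [f x], which puts [f x] both above and below
     [c]. *)
  - destruct (Hl x (d / 2)) as [N HN]; [lra|].
    destruct (Hx (S N)) as [s [n [_ [Hs [_ [[m1 [H1 K1]] [m2 [H2 K2]]]]]]]].
    specialize (K1 x Hs); specialize (K2 x Hs).
    generalize (HN m1 ltac:(lia)), (HN m2 ltac:(lia)); intros L1 L2.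
    apply Rabs_def2 in L1; apply Rabs_def2 in L2; lra.
Qed.

(** The stage at which the sequence stabilises is its own derivative, so Baire category makes it
    empty; hence a least empty stage exists for [epsilon] to select. *)
Lemma alpha_spec f p e : baire1 f -> (0 < e)%Q ->
  is_empty (P_seq f p e (alpha f p e)) /\
  forall b, is_empty (P_seq f p e b) -> ord_le (alpha f p e) b.
Proof.
  intros Hf He; unfold alpha; apply epsilon_spec, ord_least.
  destruct (pair_seq_stabilizes (hi f p e) (lo f p e)) as [a Ha].
  exists a; intros x Hx; apply P_seq_pair_seq in Hx; revert x Hx.
  apply (baire1_no_kernel f p e); auto using pair_seq_closed.
Qed.

Lemma Q_enumerable : exists en : nat -> Q, forall q, exists n, en n = q.
Proof.
  exists (fun n => let (a, b) := Cantor.of_nat n in let (c, d) := Cantor.of_nat a in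
    Qmake (Z.of_nat c - Z.of_nat d) (Pos.of_nat b)).
  intros [z b].
  exists (Cantor.to_nat (Cantor.to_nat (Z.to_nat z, Z.to_nat (- z)), Pos.to_nat b)).
  rewrite !Cantor.cancel_of_to, Pos2Nat.id; f_equal; lia.
Qed.

Lemma rank_spec f :
  (forall p e, (0 < e)%Q -> ord_le (alpha f p e) (rank f)) /\
  forall r, (forall p e, (0 < e)%Q -> ord_le (alpha f p e) r) -> ord_le (rank f) r.
Proof.
  unfold rank; apply epsilon_spec.
  destruct Q_enumerable as [en Hen].
  (* The supremum runs over codes of pairs of rationals; the default [OZ] at non-positive radii
     leaves it unchanged. *)
  exists (OL (fun n => let (i, j) := Cantor.of_nat n in
    if Qlt_le_dec 0 (en j) then alpha f (en i) (en j) else OZ)); split.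
  - intros p e He; destruct (Hen p) as [i <-], (Hen e) as [j <-].
    apply ord_le_lim with (Cantor.to_nat (i, j)); rewrite Cantor.cancel_of_to.
    destruct (Qlt_le_dec 0 (en j)) as [_|H]; [apply ord_le_refl|].
    destruct (Qlt_not_le _ _ He H).
  - intros r Hr n; destruct (Cantor.of_nat n) as [i j].
    destruct (Qlt_le_dec 0 (en j)); [auto|exact I].
Qed.

Lemma ord_lt_irrefl a : ~ ord_lt a a.
Proof. induction (ord_lt_wf a) as [a _ IH]; intros H; exact (IH a H H). Qed.

Lemma P_seq_anti f p e a b x : ord_le a b -> P_seq f p e b x -> P_seq f p e a x.
Proof. intros H; rewrite !P_seq_pair_seq; apply pair_seq_anti; exact H. Qed.

Lemma P_seq_inhabited f a : ord_lt a (rank f) -> baire1 f ->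
  exists p e x, (0 < e)%Q /\ P_seq f p e a x.
Proof.
  intros Ha Hf; apply NNPP; intros K; apply (ord_lt_irrefl a).
  apply ord_le_trans with (1 := Ha), rank_spec; intros p e He.
  apply (alpha_spec f p e Hf He); intros x Hx; apply K; eauto.
Qed.

Lemma P_seq_rank_empty f p e a : baire1 f -> (0 < e)%Q -> ord_le (rank f) a ->
  is_empty (P_seq f p e a).
Proof.
  intros Hf He Ha x Hx; apply (proj1 (alpha_spec f p e Hf He) x).
  apply P_seq_anti with (2 := Hx); apply ord_le_trans with (2 := Ha).
  apply rank_spec; exact He.
Qed.

Lemma rank_pos f : baire1 f -> ord_lt OZ (rank f).
Proof.
  intros Hf; destruct (ord_le_or_lt (rank f) OZ) as [H|H]; [|exact H].
  destruct (P_seq_rank_empty f 0 1 OZ Hf ltac:(reflexivity) H (fun _ => true)); exact I.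
Qed.

Lemma rank_limit_or_succ f : baire1 f ->
  ord_limit (rank f) \/ exists nu, ord_eq (rank f) (OS nu).
Proof.
  intros Hf; destruct (classic (exists nu, ord_eq (rank f) (OS nu))) as [H|H]; auto.
  left; split; [apply rank_pos; exact Hf|]; intros b Hb; apply H; eauto.
Qed.

(** * Sidedness *)

(** A point surviving at stage [nu] pushes [alpha] above [nu], and the rank caps it at [OS nu]. *)
Lemma maximal_intro f nu p e x : baire1 f -> ord_eq (rank f) (OS nu) ->
  (0 < e)%Q -> P_seq f p e nu x -> hi f p e x \/ lo f p e x ->
  maximal f p e nu.
Proof.
  intros Hf Hnu He Hx Hhl; split; [exact He|split; [split|]].
  - apply ord_le_trans with (2 := proj1 Hnu), rank_spec; exact He.
  - destruct (ord_le_or_lt (OS nu) (alpha f p e)) as [H|H]; [exact H|].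
    destruct (proj1 (alpha_spec f p e Hf He) x); exact (P_seq_anti f p e (alpha f p e) nu x H Hx).
  - exists x; split; [exact Hx|]; unfold hi, lo in Hhl; lra.
Qed.

Section Sidedness.
Variables (f : cantor -> R) (nu : Ord).
Hypotheses (Hf : baire1 f) (Hnu : ord_eq (rank f) (OS nu)).

Lemma rank_succ_unique nu' : ord_eq (rank f) (OS nu') -> ord_eq nu' nu.
Proof.
  intros [H1 H2]; destruct Hnu as [H3 H4].
  exact (conj (ord_le_trans _ _ _ H2 H3) (ord_le_trans _ _ _ H4 H1)).
Qed.

(** Maximality drops out by [maximal_intro], and the predecessor of the rank is unique up to
    [ord_eq], so the stage can be fixed as [nu]. The next two characterisations follow the same
    pattern. *)
Lemma two_sided_iff : two_sided f <->
  exists p e x y, (0 < e)%Q /\ P_seq f p e nu x /\ hi f p e x /\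
    P_seq f p e nu y /\ lo f p e y.
Proof.
  split.
  - intros [nu' [E [p [e [[He _] [[y [Py Ly]] [x [Px Lx]]]]]]]].
    apply rank_succ_unique in E; destruct E as [_ E].
    exists p, e, x, y; unfold hi, lo.
    repeat split; [exact He| |lra| |lra]; eapply P_seq_anti; eauto.
  - intros [p [e [x [y [He [Px [Hx [Py Hy]]]]]]]]; exists nu; split; [exact Hnu|].
    exists p, e; split; [apply maximal_intro with x; auto|]; unfold hi, lo in *.
    split; [exists y|exists x]; split; auto; lra.
Qed.

Lemma right_sided_iff : right_sided f <->
  forall p e x, (0 < e)%Q -> P_seq f p e nu x -> ~ lo f p e x.
Proof.
  split.
  - intros [nu' [E H]] p e x He Px Lx.
    apply (P_seq_anti f p e nu' nu) in Px; [|apply (rank_succ_unique _ E)].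
    specialize (H p e (maximal_intro f nu' p e x Hf E He Px (or_intror Lx)) x Px).
    unfold lo in Lx; lra.
  - intros H; exists nu; split; [exact Hnu|]; intros p e [He _] x Px.
    apply Rnot_le_lt; exact (H p e x He Px).
Qed.

Lemma left_sided_iff : left_sided f <->
  forall p e x, (0 < e)%Q -> P_seq f p e nu x -> ~ hi f p e x.
Proof.
  split.
  - intros [nu' [E H]] p e x He Px Hx.
    apply (P_seq_anti f p e nu' nu) in Px; [|apply (rank_succ_unique _ E)].
    specialize (H p e (maximal_intro f nu' p e x Hf E He Px (or_introl Hx)) x Px).
    unfold hi in Hx; lra.
  - intros H; exists nu; split; [exact Hnu|]; intros p e [He _] x Px.
    apply Rnot_le_lt; exact (H p e x He Px).
Qed.

(* Replacing the window [(p - e, p + e)] by its half that omits [f x] can only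
   enlarge the derived set. *)
Lemma extreme_value_exists :
  exists p e x, (0 < e)%Q /\ P_seq f p e nu x /\ (hi f p e x \/ lo f p e x).
Proof.
  destruct (P_seq_inhabited f nu (proj2 Hnu) Hf) as [p [e [x [He Px]]]].
  assert (He2 : (0 < e * (1 # 2))%Q) by (unfold Qlt in *; simpl in *; lia).
  assert (E2 : Q2R (e * (1 # 2)) = Q2R e / 2).
  { rewrite Q2R_mult; unfold Q2R at 2; simpl; lra. }
  pose proof (Q2R_pos e He) as Hpos.
  assert (Hmono : forall q,
    Q2R q + Q2R e / 2 <= Q2R p + Q2R e -> Q2R p - Q2R e <= Q2R q - Q2R e / 2 ->
    P_seq f q (e * (1 # 2)) nu x).
  { intros q H1 H2; apply P_seq_pair_seq; apply P_seq_pair_seq in Px.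
    apply (pair_seq_image (hi f p e) (lo f p e) _ _ (fun z => z)) with (x := x); [| |exact Px].
    - intros z n; exists n; auto.
    - intros z; unfold hi, lo; rewrite E2; lra. }
  (* The new window is (p, p + e) in the first case and (p - e, p) in the second. *)
  destruct (Rle_or_lt (f x) (Q2R p)) as [H|H].
  - exists (p + e * (1 # 2))%Q, (e * (1 # 2))%Q, x; split; [exact He2|].
    split; [apply Hmono|right; unfold lo]; rewrite Q2R_plus, E2; lra.
  - exists (p - e * (1 # 2))%Q, (e * (1 # 2))%Q, x; split; [exact He2|].
    split; [apply Hmono|left; unfold hi]; rewrite Q2R_minus, E2; lra.
Qed.

End Sidedness.

(** * The comparison theorem *)

Lemma m_le_iff_pair_le f g : m_le f g <->
  forall p e, (0 < e)%Q -> exists q d, (0 < d)%Q /\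
    pair_le (hi f p e) (lo f p e) (hi g q d) (lo g q d).
Proof.
  split; intros H p e He; destruct (H p e He) as [q [d [Hd [k [Hc Hk]]]]];
    exists q, d; split; auto; exists k; split; auto.
  - intros x; unfold hi, lo; split; intros Hx; apply Rnot_lt_le; intros L.
    + destruct (Hk x true) as [[_ K]|[K _]]; [left; auto|lra|discriminate].
    + destruct (Hk x false) as [[K _]|[_ K]]; [right; auto|discriminate|lra].
  - intros x b; destruct (Hk x) as [K1 K2]; unfold hi, lo in *.
    intros [[-> L]|[-> L]]; [left|right]; split; auto; apply Rnot_le_lt; intros M.
    + specialize (K1 M); lra.
    + specialize (K2 M); lra.
Qed.

Lemma m_le_of_lower_stages f g : baire1 g ->
  (forall p e, (0 < e)%Q -> exists a, is_empty (P_seq f p e a) /\ ord_lt a (rank g)) ->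
  m_le f g.
Proof.
  intros Hg H; apply m_le_iff_pair_le; intros p e He.
  destruct (H p e He) as [a [Ha Hlt]], (P_seq_inhabited g a Hlt Hg) as [q [d [y [Hd Hy]]]].
  exists q, d; split; [exact Hd|]; apply pair_le_empty with a y.
  - intros x Hx; apply (Ha x); apply P_seq_pair_seq; exact Hx.
  - apply P_seq_pair_seq; exact Hy.
Qed.

Lemma m_le_of_rank_lt f g : baire1 f -> baire1 g -> ord_lt (rank f) (rank g) -> m_le f g.
Proof.
  intros Hf Hg H; apply m_le_of_lower_stages; auto.
  intros p e He; exists (rank f); split; [|exact H].
  apply P_seq_rank_empty; auto using ord_le_refl.
Qed.

(* The first empty stage is a successor by compactness, hence strictly below a limit rank. *)
Lemma m_le_of_rank_limit f g : baire1 f -> baire1 g ->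
  ord_eq (rank f) (rank g) -> ord_limit (rank f) -> m_le f g.
Proof.
  intros Hf Hg [E1 E2] [_ HL]; apply m_le_of_lower_stages; auto.
  intros p e He.
  destruct (pair_seq_empty_succ (hi f p e) (lo f p e) (rank f)) as [m [Hm Hm']].
  { intros x Hx; apply (P_seq_rank_empty f p e (rank f) Hf He (ord_le_refl _) x).
    apply P_seq_pair_seq; exact Hx. }
  exists (OS m); split.
  - intros x Hx; apply (Hm' x); apply P_seq_pair_seq; exact Hx.
  - destruct (ord_le_or_lt (rank g) (OS m)) as [H|H]; [|exact H].
    destruct (HL m); split; [exact (ord_le_trans _ _ _ E1 H)|exact Hm].
Qed.

Lemma m_le_iff_of_rank_succ f g nu : baire1 f -> baire1 g ->
  ord_eq (rank f) (OS nu) -> ord_eq (rank g) (OS nu) ->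
  (m_le f g <->
     two_sided g \/
     (one_sided f /\ ~ right_sided g /\ ~ left_sided g) \/
     (right_sided f /\ right_sided g) \/
     (left_sided f /\ left_sided g)).
Proof.
  intros Hf Hg Ef Eg; unfold one_sided.
  rewrite (two_sided_iff f nu), (two_sided_iff g nu), (right_sided_iff f nu),
    (right_sided_iff g nu), (left_sided_iff f nu), (left_sided_iff g nu) by assumption.
  (* One surviving extreme point of [g] handles every pair of [f] that has no survivor of the
     opposite kind at stage [nu]. *)
  assert (to_hi : forall p e q d y, (0 < d)%Q ->
    P_seq g q d nu y -> hi g q d y ->
    (forall x, P_seq f p e nu x -> ~ lo f p e x) ->
    exists q d, (0 < d)%Q /\ pair_le (hi f p e) (lo f p e) (hi g q d) (lo g q d)).
  { intros p e q d y Hd Py Hy K; exists q, d; split; [exact Hd|].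
    apply P_seq_pair_seq in Py; apply pair_le_point with nu y; [exact Py|].
    intros x Px; apply P_seq_pair_seq in Px; specialize (K x Px); tauto. }
  assert (to_lo : forall p e q d y, (0 < d)%Q ->
    P_seq g q d nu y -> lo g q d y ->
    (forall x, P_seq f p e nu x -> ~ hi f p e x) ->
    exists q d, (0 < d)%Q /\ pair_le (hi f p e) (lo f p e) (hi g q d) (lo g q d)).
  { intros p e q d y Hd Py Hy K; exists q, d; split; [exact Hd|].
    apply P_seq_pair_seq in Py; apply pair_le_point with nu y; [exact Py|].
    intros x Px; apply P_seq_pair_seq in Px; specialize (K x Px); tauto. }
  rewrite m_le_iff_pair_le; split.
  - intros H.
    (* Surviving extreme points of [f] go to survivors of the same kind, both kinds for one and the
       same pair [q], [d]; so a two-sided [f] forces a two-sided [g]. *)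
    assert (image : forall p e, (0 < e)%Q -> exists q d, (0 < d)%Q /\
      ((exists x, P_seq f p e nu x /\ hi f p e x) ->
        exists y, P_seq g q d nu y /\ hi g q d y) /\
      ((exists x, P_seq f p e nu x /\ lo f p e x) ->
        exists y, P_seq g q d nu y /\ lo g q d y)).
    { intros p e He; destruct (H p e He) as [q [d [Hd [k [Hc Hk]]]]].
      exists q, d; split; [exact Hd|].
      split; intros [x [Px Sx]]; exists (k x); (split; [|apply Hk; exact Sx]);
        apply P_seq_pair_seq; apply P_seq_pair_seq in Px;
        exact (pair_seq_image _ _ _ _ k nu Hc Hk x Px). }
    match goal with |- ?T \/ _ => destruct (classic T) as [T0|T0]; [left; exact T0|] end.
    right.
    match goal with |- _ \/ (?R1 /\ ?R2) \/ (?L1 /\ ?L2) =>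
      destruct (classic R2) as [HR|HR]; [|destruct (classic L2) as [HL|HL]] end.
    + right; left; split; [|exact HR]; intros p e x He Px Lx.
      destruct (image p e He) as [q [d [Hd [_ K]]]], K as [y [Py Ly]]; [eauto|].
      exact (HR q d y Hd Py Ly).
    + right; right; split; [|exact HL]; intros p e x He Px Lx.
      destruct (image p e He) as [q [d [Hd [K _]]]], K as [y [Py Ly]]; [eauto|].
      exact (HL q d y Hd Py Ly).
    + left; split; [|split; assumption].
      intros [p [e [x [x' [He [Px [Hx [Px' Hx']]]]]]]]; apply T0.
      destruct (image p e He) as [q [d [Hd [K1 K2]]]].
      destruct K1 as [y [Py Hy]]; [eauto|]; destruct K2 as [y' [Py' Hy']]; [eauto|].
      exists q, d, y, y'; auto.
  - intros [H|[[Hone [HnR HnL]]|[[HRf HRg]|[HLf HLg]]]] p e He.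
    + destruct H as [q [d [y [y' [Hd [Py [Hy [Py' Hy']]]]]]]].
      exists q, d; split; [exact Hd|]; apply P_seq_pair_seq in Py, Py'.
      apply pair_le_two_points with nu y y'; auto.
      intros x Hx; apply (P_seq_rank_empty f p e (OS nu) Hf He (proj1 Ef) x).
      apply P_seq_pair_seq; exact Hx.
    (* [g] has a low survivor for some pair and a high one for a possibly different pair; [f] being
       one-sided, each of its pairs needs only one of them. *)
    + assert (exists q d y, (0 < d)%Q /\ P_seq g q d nu y /\ lo g q d y)
        as [q [d [y [Hd [Py Hy]]]]].
      { apply NNPP; intros K; apply HnR; intros q d y Hd Py Hy; apply K.
        exists q, d, y; auto. }
      assert (exists q d y, (0 < d)%Q /\ P_seq g q d nu y /\ hi g q d y)
        as [q' [d' [y' [Hd' [Py' Hy']]]]].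
      { apply NNPP; intros K; apply HnL; intros q' d' y' Hd' Py' Hy'; apply K.
        exists q', d', y'; auto. }
      destruct (classic (exists x, P_seq f p e nu x /\ lo f p e x)) as [[x [Px Lx]]|Hno].
      * apply to_lo with q d y; auto; intros x' Px' Hx'; apply Hone.
        exists p, e, x', x; auto.
      * apply to_hi with q' d' y'; auto; intros x Px Lx; apply Hno; eauto.
    (* A right-sided [g] has no low survivor, so its extreme value is high; the left-sided case is
       symmetric. *)
    + destruct (extreme_value_exists g nu Hg Eg) as [q [d [y [Hd [Py [Hy|Hy]]]]]].
      * apply to_hi with q d y; auto; intros x Px; exact (HRf p e x He Px).
      * destruct (HRg q d y Hd Py Hy).
    + destruct (extreme_value_exists g nu Hg Eg) as [q [d [y [Hd [Py [Hy|Hy]]]]]].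
      * destruct (HLg q d y Hd Py Hy).
      * apply to_lo with q d y; auto; intros x Px; exact (HLf p e x He Px).
Qed.

Theorem mainTheorem2 (f g : cantor -> R) (hf : baire1 f) (hg : baire1 g) :
  (ord_lt (rank f) (rank g) -> m_le f g) /\
  (ord_eq (rank f) (rank g) ->
     (m_le f g <->
        (ord_limit (rank f) \/
         two_sided g \/
         (one_sided f /\ ~ right_sided g /\ ~ left_sided g) \/
         (right_sided f /\ right_sided g) \/
         (left_sided f /\ left_sided g)))).
Proof.
  split; [apply m_le_of_rank_lt; assumption|].
  intros E; destruct (rank_limit_or_succ f hf) as [HL|[nu Ef]].
  - split; [left; exact HL|]; intros _; apply m_le_of_rank_limit; assumption.
  - assert (Eg : ord_eq (rank g) (OS nu)).
    { destruct E as [E1 E2], Ef as [F1 F2].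
      exact (conj (ord_le_trans _ _ _ E2 F1) (ord_le_trans _ _ _ F2 E1)). }
    assert (Hnl : ~ ord_limit (rank f)) by (intros [_ H]; exact (H nu Ef)).
    pose proof (m_le_iff_of_rank_succ f g nu hf hg Ef Eg); tauto.
Qed.
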